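(* Let $a_1,\dots,a_m\in\mathbb{R}^n$, let $\ell_i:\mathbb{R}\to\mathbb{R}$ be $C^2$ for $i=1,\dots,m$, let $f(z)=\sum_{i=1}^{m}\ell_i(a_i^\top z)$ on $\mathbb{R}^n$, and let $A=[a_1,\dots,a_m]^\top\in\mathbb{R}^{m\times n}$. Suppose $f$ is coercive on the row space $\mathcal{R}=\operatorname{row}(A)=\operatorname{span}\{a_1,\dots,a_m\}$. Then for every $\varepsilon>0$ and every start $z_0\in\mathcal{R}$ (for instance $z_0=0$), $$V(z_0)\le V_0(z_0)\le\operatorname{rank}(A),$$ a bound independent of the ambient dimension $n$.
   Context: A (first-order) trajectory from $z_0$ is a sequence with $z_{k+1}=z_0-\sum_{j=0}^{k}c_{k,j}\,\nabla f(z_j)$, with arbitrary real coefficients $c_{k,j}$. $V(z_0)$ is the least $K\in\{0,1,2,\dots\}$ for which some trajectory $z_0,\dots,z_K$ has $\|\nabla f(z_K)\|\le\varepsilon$, and $V_0(z_0)$ is the least $K$ for which some trajectory has $\nabla f(z_K)=0$ (each $\infty$ if there is none). Coercive on a subspace $\mathcal{R}$ means radially unbounded there: $f(z)\to+\infty$ as $\|z\|\to\infty$, $z\in\mathcal{R}$. *)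

(* Defs.v *)
From mathcomp Require Import all_boot all_order all_algebra.
From mathcomp Require Import boolp classical_sets reals ereal topology.
From mathcomp Require Import normedtype derive.

Set Implicit Arguments.
Unset Strict Implicit.
Unset Printing Implicit Defensive.

Import Order.TTheory GRing.Theory Num.Theory.
Import numFieldTopology.Exports numFieldNormedType.Exports.

Local Open Scope ring_scope.
Local Open Scope classical_set_scope.

(* Vectors of R^n are row vectors, so that the row space of A : 'M_(m, n)     *)
(* is the set of z : 'rV_n such that (z <= A)%MS.                             *)

Definition dotv (R : realType) (n : nat) (u v : 'rV[R]_n) : R :=
  \sum_(j < n) u 0 j * v 0 j.

(* The norm `|v| on matrices is the sup norm, whence a separate definition.   *)
Definition enorm (R : realType) (n : nat) (v : 'rV[R]_n) : R :=
  Num.sqrt (\sum_(j < n) v 0 j ^+ 2).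

Definition C2 (R : realType) (l : R -> R) : Prop :=
  [/\ forall x, derivable l x 1,
      forall x, derivable l^`() x 1 &
      continuous l^`(2)].

Definition grad (R : realType) (n : nat) (f : 'rV[R]_n -> R) (z : 'rV[R]_n) :
    'rV[R]_n :=
  \row_(j < n) 'D_(delta_mx 0 j) f z.

Definition coercive_on (R : realType) (n : nat) (U : set 'rV[R]_n)
    (f : 'rV[R]_n -> R) : Prop :=
  forall M : R, exists r : R, forall z, U z -> r < enorm z -> M < f z.

(* Only the terms z 0, ..., z K of the sequence z are constrained.            *)
Definition trajectory (R : realType) (n : nat) (f : 'rV[R]_n -> R)
    (z0 : 'rV[R]_n) (K : nat) (z : nat -> 'rV[R]_n) : Prop :=
  z 0%N = z0 /\
  exists c : nat -> nat -> R, forall k, (k < K)%N ->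
    z k.+1 = z0 - \sum_(j < k.+1) c k j *: grad f (z j).

(* The least natural number satisfying P, or +oo if there is none.            *)
Definition least (R : realType) (P : nat -> Prop) : \bar R :=
  match pselect (exists K, `[< P K >]) with
  | left exP => ((ex_minn (P := fun K => `[< P K >]) exP)%:R)%:E
  | right _ => +oo%E
  end.

Definition V (R : realType) (n : nat) (f : 'rV[R]_n -> R) (eps : R)
    (z0 : 'rV[R]_n) : \bar R :=
  least R (fun K => exists2 z, trajectory f z0 K z & enorm (grad f (z K)) <= eps).

Definition V0 (R : realType) (n : nat) (f : 'rV[R]_n -> R)
    (z0 : 'rV[R]_n) : \bar R :=
  least R (fun K => exists2 z, trajectory f z0 K z & grad f (z K) = 0).

(* Main.v *)
(** The iterate [z_(k+1)] minimizes [f] over [z_0 + span (g_0, ..., g_k)], where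
    [g_j] is the gradient of [f] at [z_j]; a minimizer exists by coercivity,
    because all gradients lie in the row space of [A]. By first-order optimality
    [g_(k+1)] is orthogonal to [g_0, ..., g_k], so [g_0, ..., g_r] with
    [r = \rank A] are [r + 1] pairwise orthogonal vectors of a space of dimension
    [r], and one of them vanishes. *)

Require Import Defs.
From mathcomp Require Import all_boot all_order all_algebra.
From mathcomp Require Import boolp classical_sets functions reals ereal topology.
From mathcomp Require Import normedtype derive.

Import Order.TTheory GRing.Theory Num.Theory.
Import numFieldTopology.Exports numFieldNormedType.Exports.

Local Open Scope ring_scope.
Local Open Scope classical_set_scope.

Lemma least_le (R : realType) (P : nat -> Prop) (K : nat) :
  P K -> (least R P <= (K%:R)%:E)%E.
Proof.
move=> PK; rewrite /least; case: pselect => [exP|[]]; last first.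
  by exists K; exact/asboolP.
by rewrite lee_fin ler_nat; case: ex_minnP => k _; apply; exact/asboolP.
Qed.

Lemma least_mono (R : realType) (P Q : nat -> Prop) :
  (forall K, P K -> Q K) -> (least R Q <= least R P)%E.
Proof.
move=> PQ; rewrite {2}/least; case: pselect => [exP|_]; last exact: leey.
by case: ex_minnP => k /asboolP /PQ + _; exact: least_le.
Qed.

Lemma dotvE (R : realType) (n : nat) (u v : 'rV[R]_n) :
  dotv u v = (u *m v^T) 0 0.
Proof. by rewrite mxE; apply: eq_bigr => j _; rewrite mxE. Qed.

Lemma dotvC (R : realType) (n : nat) (u v : 'rV[R]_n) : dotv u v = dotv v u.
Proof. by apply: eq_bigr => j _; rewrite mulrC. Qed.

Lemma dotv_eq0 (R : realType) (n : nat) (u : 'rV[R]_n) : (dotv u u == 0) = (u == 0).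
Proof.
apply/idP/eqP => [|->]; last by rewrite dotvE mul0mx mxE.
rewrite psumr_eq0 => [/allP u0|j _]; last by rewrite -expr2 sqr_ge0.
apply/rowP => j; rewrite mxE; apply/eqP.
by have := u0 j (mem_index_enum j); rewrite /= mulf_eq0 orbb.
Qed.

Lemma enorm0 (R : realType) (n : nat) : enorm (0 : 'rV[R]_n) = 0.
Proof. by rewrite /enorm big1 ?sqrtr0// => j _; rewrite mxE expr0n. Qed.

Lemma normr_le_enorm (R : realType) (n : nat) (v : 'rV[R]_n) : `|v| <= enorm v.
Proof.
rewrite -[leLHS]/(mx_norm v) mx_normrE; apply/bigmax_leP; split; first exact: sqrtr_ge0.
move=> [i j] _ /=; rewrite ord1 -sqrtr_sqr ler_wsqrtr// (bigD1 j)//= lerDl.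
by rewrite sumr_ge0// => k _; rewrite sqr_ge0.
Qed.

(** The Gram matrix of the family is diagonal with nonzero diagonal entries, hence invertible of
    rank [p]; as a product with left factor [G], it has rank at most that of [G], whose rows lie in
    the row space of [A]. *)
Lemma pairwise_orthogonal_leq_rank {R : realType} {p m n : nat}
    (g : 'I_p -> 'rV[R]_n) (A : 'M[R]_(m, n)) :
  (forall i, g i <= A)%MS -> (forall i, g i != 0) ->
  (forall i j, i != j -> dotv (g i) (g j) = 0) -> (p <= \rank A)%N.
Proof.
move=> gA g0 gort; pose G := \matrix_i g i.
have GG : G *m G^T = diag_mx (\row_i dotv (g i) (g i)).
  apply/matrixP => i j; rewrite !mxE.
  rewrite (_ : \sum_ _ _ = dotv (g i) (g j)); last first.
    by apply: eq_bigr => k _; rewrite !mxE.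
  by case: eqVneq => [->|/gort ->]; rewrite ?mulr1n ?mulr0n.
have <- : \rank (G *m G^T) = p.
  rewrite GG mxrank_unit// unitmxE det_diag unitfE; apply/prodf_neq0 => i _.
  by rewrite mxE dotv_eq0.
apply: leq_trans (mxrankM_maxl _ _) _; apply: mxrankS.
by apply/row_subP => i; rewrite rowK.
Qed.

Lemma derive_dotv (R : realType) (n : nat) (f : 'rV[R]_n -> R) (z v : 'rV[R]_n) :
  differentiable f z -> 'D_v f z = dotv (grad f z) v.
Proof.
move=> df; rewrite deriveE// {1}[v]row_sum_delta linear_sum.
by apply: eq_bigr => j _; rewrite linearZ mxE deriveE// mulrC.
Qed.

(** Fermat's rule for the restriction [g] of [f] to the line through [z] directed by [v]. It serves
    both at minimizers over an affine subspace and along directions in which [f] is constant. *)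
Lemma dotv_grad_min (R : realType) (n : nat) (f : 'rV[R]_n -> R)
    (z v : 'rV[R]_n) : (forall x, differentiable f x) ->
  (forall t, f z <= f (t *: v + z)) -> dotv (grad f z) v = 0.
Proof.
move=> df fmin; rewrite -derive_dotv//.
pose g (t : R) := f (t *: v + z).
have -> : 'D_v f z = 'D_1 g 0.
  rewrite /derive; set d := fun h => _; set d' := fun h => _.
  suff -> : d = d' by [].
  by apply/funext => h; rewrite /d /d' /g /= addr0 [h *: 1]mulr1 scale0r add0r.
have dg t : derivable g t 1.
  by apply/derivable1_diffP; apply: differentiable_comp.
have [] // : is_derive (0 : R) 1 g 0.
(* The minimum at 0 is global; [-1] and [1] merely bound some open interval around it. *)
apply: (@derive1_at_min _ _ (- 1) 1) => [|t _||t _] //.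
- by rewrite in_itv/= ltrN10 ltr01.
- by rewrite /g scale0r add0r.
Qed.

Lemma differentiable_dotv (R : realType) (n : nat) (u z : 'rV[R]_n) :
  differentiable (dotv u) z.
Proof.
rewrite (_ : dotv u = \sum_(j < n) (fun v : 'rV_n => u 0 j * v 0 j)).
  by apply: differentiable_sum => j; exact/differentiableZ/differentiable_coord.
by apply/funext => v; rewrite fct_sumE.
Qed.

Lemma dotv_colE (R : realType) (p n : nat) (C : 'M[R]_(n, p)) (z : 'rV[R]_n) j :
  dotv (col j C)^T z = (z *m C) 0 j.
Proof. by rewrite dotvC dotvE trmxK !mxE; apply: eq_bigr => k _; rewrite mxE. Qed.

(** The row space is the common kernel of the continuous linear forms given by the columns of
    [cokermx G]. *)
Lemma closed_submx (R : realType) (p n : nat) (G : 'M[R]_(p, n)) :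
  closed [set z : 'rV[R]_n | (z <= G)%MS].
Proof.
rewrite (_ : mkset _ =
    \bigcap_(j in setT) (dotv (col j (cokermx G))^T @^-1` [set x | x = 0])).
  apply: closed_bigI => j _; apply: preimage_closed; last exact: closed_eq.
  by move=> z _; exact/differentiable_continuous/differentiable_dotv.
apply/seteqP; split => z /=; rewrite submxE; last move=> zG.
  by move=> /eqP zG j _; rewrite /= dotv_colE zG mxE.
by apply/eqP/rowP => j; rewrite -dotv_colE zG// mxE.
Qed.

(** The affine subspace lies in the row space of [A], where [f] is coercive, so its part [S] below
    the level [f z0] is compact and nonempty; a minimizer over [S] is also one over the whole affine
    subspace. *)
Lemma exists_affine_min {R : realType} {p m n : nat} {f : 'rV[R]_n -> R}
    {A : 'M[R]_(m, n)} (G : 'M[R]_(p, n)) (z0 : 'rV[R]_n) :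
  continuous f -> coercive_on [set z | (z <= A)%MS] f ->
  (G <= A)%MS -> (z0 <= A)%MS ->
  exists2 z, (z - z0 <= G)%MS & forall w, (w - z0 <= G)%MS -> f z <= f w.
Proof.
move=> cf coer GA z0A; have [r fr] := coer (f z0).
pose S := [set z : 'rV[R]_n | (z - z0 <= G)%MS /\ f z <= f z0].
have Sz0 : S z0 by split=> //; rewrite subrr sub0mx.
have Gmin z : (z - z0 <= G)%MS -> (z <= A)%MS.
  by move=> zG; rewrite -[z](subrK z0) addmx_sub// (submx_trans zG).
have cS : compact S.
  (* Boundedness refers to the sup norm, which is dominated by the Euclidean norm used in
     coercivity. *)
  apply: bounded_closed_compact.
    exists r; split; first exact: num_real.
    move=> M rM z [/Gmin zA fz]; apply/ltW/(le_lt_trans (normr_le_enorm _ _ _)).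
    apply: le_lt_trans rM; rewrite leNgt; apply/negP => /(fr z zA).
    by rewrite ltNge fz.
  apply: closedI; last by apply: preimage_closed (@closed_le _ _) => ? _; exact: cf.
  apply: (@preimage_closed _ _ (fun z : 'rV[R]_n => z - z0) [set z | (z <= G)%MS]);
    last exact: closed_submx.
  move=> z _; apply: (@differentiable_continuous R 'rV[R]_n 'rV[R]_n).
  exact: differentiableB.
have fS : {within S, continuous f} by exact: continuous_subspaceT cf.
have [z /set_mem[zG _] zmin] := EVT_min_rV (ex_intro _ z0 Sz0) cS fS.
(* A point [w] outside [S] has a value above [f z0], which is itself at least [f z]. *)
exists z => // w wG; have [wz0|/ltW wz0] := leP (f w) (f z0).
  by apply: zmin; apply/mem_set.
by apply: le_trans wz0; apply: zmin; exact/mem_set.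
Qed.

Lemma exists_orthogonal_trajectory {R : realType} {m n : nat}
    {f : 'rV[R]_n -> R} {A : 'M[R]_(m, n)} {z0 : 'rV[R]_n} (K : nat) :
  (forall z, differentiable f z) -> (forall z, grad f z <= A)%MS ->
  coercive_on [set z | (z <= A)%MS] f -> (z0 <= A)%MS ->
  exists2 z, trajectory f z0 K z &
    forall i j, (i < j <= K)%N -> dotv (grad f (z i)) (grad f (z j)) = 0.
Proof.
move=> df gA coer z0A; elim: K => [|K [z [zz0 [c zc]] zort]].
  exists (fun=> z0); first by split=> //; exists (fun _ _ => 0).
  by move=> i [|j]; rewrite ?ltn0 ?andbF.
pose G := \matrix_(j < K.+1) grad f (z j).
have GA : (G <= A)%MS by apply/row_subP => j; rewrite rowK.
have cf : continuous f by move=> x; exact: differentiable_continuous.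
have [w wG wmin] := exists_affine_min G z0 cf coer GA z0A.
have /submxP[D wD] := wG.
exists (fun j => if j == K.+1 then w else z j).
  (* The new coefficients are the coordinates of [w - z0] in the rows of [G], negated because
     trajectories subtract the sum. *)
  split=> //; exists (fun k j => if k == K then - D 0 (inord j) else c k j).
  move=> k; rewrite ltnS leq_eqVlt eqSS => /predU1P[->|kK].
    rewrite eqxx -[w](subrK z0) wD addrC mulmx_sum_row -sumrN.
    congr (_ + _); apply: eq_bigr => j _.
    by rewrite inord_val rowK scaleNr opprK ltn_eqF.
  rewrite (ltn_eqF kK) (zc k kK); congr (_ - _); apply: eq_bigr => j _.
  by rewrite (ltn_eqF (leq_trans (ltn_ord j) _))// ltnS ltnW.
move=> i j /andP[ij]; rewrite leq_eqVlt ltnS => /predU1P[jE|jK]; last first.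
  by rewrite !ltn_eqF ?zort ?ij// ltnS// ltnW// (leq_trans ij).
rewrite jE eqxx ltn_eqF -?jE// dotvC; apply: dotv_grad_min => // t.
(* Moving from [w] along an earlier gradient, a row of [G], stays in the affine subspace over which
   [w] is minimal. *)
apply: wmin; rewrite -addrA; apply: addmx_sub wG; apply: scalemx_sub.
have iK : (i < K.+1)%N by rewrite -jE.
by rewrite (_ : grad f (z i) = row (Ordinal iK) G) ?row_sub// rowK.
Qed.

Lemma V0_le_rank (R : realType) (m n : nat)
    (f : 'rV[R]_n -> R) (A : 'M[R]_(m, n)) (z0 : 'rV[R]_n) :
  (forall z, differentiable f z) -> (forall z, grad f z <= A)%MS ->
  coercive_on [set z | (z <= A)%MS] f -> (z0 <= A)%MS ->
  (V0 f z0 <= ((\rank A)%:R)%:E)%E.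
Proof.
move=> df gA coer z0A.
have [z [zz0 [c zc]] zort] := exists_orthogonal_trajectory (\rank A) df gA coer z0A.
have [K gK] : exists K : 'I_(\rank A).+1, grad f (z K) = 0.
  apply: contrapT => /forallNP g0; suff : ((\rank A).+1 <= \rank A)%N by rewrite ltnn.
  apply: (pairwise_orthogonal_leq_rank (fun i => grad f (z i))) => // [i|i j].
    exact/eqP/g0.
  rewrite -val_eqE neq_ltn => /orP[] ij; last rewrite dotvC.
    by apply: zort; rewrite ij leq_ord.
  by apply: zort; rewrite ij leq_ord.
(* The gradient may vanish before step [\rank A]; the trajectory cut at [K] is then the witness. *)
apply: le_trans (least_le R _ K _) _; last by rewrite lee_fin ler_nat leq_ord.
exists z => //; split=> //; exists c => k kK; apply: zc.
by rewrite (leq_trans kK)// leq_ord.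
Qed.

Theorem corollary1 (R : realType) (m n : nat)
    (a : 'I_m -> 'rV[R]_n) (l : 'I_m -> R -> R)
    (hl : forall i, C2 (l i)) :
  let f := fun z : 'rV[R]_n => \sum_(i < m) l i (dotv (a i) z) in
  let A : 'M[R]_(m, n) := \matrix_(i < m) a i in
  coercive_on [set z | (z <= A)%MS] f ->
  forall (eps : R) (z0 : 'rV[R]_n), 0 < eps -> (z0 <= A)%MS ->
    (V f eps z0 <= V0 f z0)%E /\ (V0 f z0 <= ((\rank A)%:R)%:E)%E.
Proof.
move=> f A coer eps z0 eps0 z0A; split.
  apply: least_mono => K [z tz gz]; exists z => //.
  by rewrite gz enorm0 ltW.
have df z : differentiable f z.
  rewrite (_ : f = \sum_(i < m) (l i \o dotv (a i))); last first.
    by apply/funext => x; rewrite fct_sumE.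
  apply: differentiable_sum => i; apply: differentiable_comp.
    exact: differentiable_dotv.
  by apply/derivable1_diffP; case: (hl i).
apply: V0_le_rank coer z0A => // z.
(* It remains to see that the gradient is orthogonal to each column of [cokermx A]. All [a k] are
   orthogonal to that column, so [f] is constant along it and any [z] is trivially a minimizer on
   its line. *)
rewrite submxE; apply/eqP/rowP => j.
rewrite -dotv_colE dotvC mxE; apply: dotv_grad_min => // t.
rewrite le_eqVlt; apply/predU1P; left; apply: eq_bigr => k _; congr (l k _).
have aA : a k *m cokermx A = 0 by apply/eqP; rewrite -submxE -(rowK a) row_sub.
rewrite !dotvE linearD linearZ /= mulmxDr -scalemxAr [RHS]mxE [X in _ = X + _]mxE.
by rewrite -!dotvE [X in _ * X]dotvC dotv_colE aA mxE mulr0 add0r.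
Qed.
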